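(* Let $I\subset\mathbb{R}$ be an open interval containing $0$ and let $x: I\to E_1^4$ be a spacelike curve in Minkowski space-time, parameterized by arclength $s$, with Frenet frame $\{T,N,B_1,B_2\}$, causal sign $\varepsilon_1=g(N,N)\in\{+1,-1\}$, and curvature functions $k_1,k_2,k_3$, all nowhere zero on $I$. Put $\theta(s)=\int_0^s k_3(t)\,dt$, and let $\eta(\theta)=\cosh\theta$, $\mu(\theta)=\sinh\theta$ if $\varepsilon_1=+1$, and $\eta(\theta)=\cos\theta$, $\mu(\theta)=\sin\theta$ if $\varepsilon_1=-1$. Then $x$ is a helix in $E_1^4$ if and only if there exist constants $C_1,C_2\in\mathbb{R}$ such that $$\frac{k_1}{k_2}(s)=C_1\,\eta(\theta(s))+C_2\,\mu(\theta(s))\qquad\text{for all } s\in I.$$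
   Context: Minkowski space-time $E_1^4$ is $\mathbb{R}^4$ with the metric $g=-dx_1^2+dx_2^2+dx_3^2+dx_4^2$. A vector $v$ is spacelike if $g(v,v)>0$ or $v=0$, timelike if $g(v,v)<0$, and null (lightlike) if $g(v,v)=0$ and $v\ne 0$. A curve is spacelike if all its velocity vectors are spacelike; it is parameterized by arclength $s$ if $g(x'(s),x'(s))=1$. Curves are assumed sufficiently smooth. Frenet frame: along an arclength-parameterized spacelike curve $x(s)$ there is a moving frame $\{T,N,B_1,B_2\}$ of mutually orthogonal vector fields (tangent $T=x'$, principal normal, first binormal, second binormal) with $$g(T,T)=1,\quad g(N,N)=\varepsilon_1,\quad g(B_2,B_2)=\varepsilon_2,\quad g(B_1,B_1)=-\varepsilon_1\varepsilon_2,\quad \varepsilon_1=\pm1,\ \varepsilon_2=\pm1,$$ where $(\varepsilon_1,\varepsilon_2)\in\{(1,1),(1,-1),(-1,1)\}$, satisfying the Frenet equations $$T'=k_1N,\quad N'=-\varepsilon_1k_1T+k_2B_1,\quad B_1'=\varepsilon_2k_2N+k_3B_2,\quad B_2'=\varepsilon_1k_3B_1.$$ The functions $k_1,k_2,k_3$ are the first, second and third curvatures. It is assumed throughout that $k_i(s)\neq 0$ for all $s$ and $1\le i\le 3$. Helix: a spacelike curve in $E_1^4$ is a (general) helix if its unit tangent indicatrix $s\mapsto T(s)$ is contained in a hyperplane (not necessarily through the origin), that is, if there is a nonzero constant vector $U\in E_1^4$ (the axis, which may be spacelike, timelike or null) such that $g(T(s),U)$ is constant. *)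

(* Defs.v *)
From Stdlib Require Import Reals.
From Coquelicot Require Import Coquelicot.

Local Open Scope R_scope.

(* The normed-module structure of the product is only used for
   limits and derivatives of curves; the geometry is that of [g] below. *)
Definition E14 : Type := (R * R * R * R)%type.

Definition g (u v : E14) : R :=
  let '(u1, u2, u3, u4) := u in
  let '(v1, v2, v3, v4) := v in
  - (u1 * v1) + u2 * v2 + u3 * v3 + u4 * v4.

Definition spacelike (v : E14) : Prop := 0 < g v v \/ v = (0, 0, 0, 0).

(* The open interval ]a, b[, possibly unbounded. *)
Definition open_itv (a b : Rbar) (s : R) : Prop := Rbar_lt a s /\ Rbar_lt s b.

(* Fields along a curve are total functions on [R]; only their values on the
   interval [I], which is open in all uses, are constrained. *)
Definition C1_on (I : R -> Prop) (V : R -> E14) : Prop :=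
  exists V' : R -> E14,
    forall s, I s -> is_derive V s (V' s) /\ continuous V' s.

Definition tangent_field (I : R -> Prop) (x T : R -> E14) : Prop :=
  forall s, I s -> is_derive x s (T s).

Definition spacelike_curve (I : R -> Prop) (x : R -> E14) : Prop :=
  exists T, tangent_field I x T /\ forall s, I s -> spacelike (T s).

Definition arclength_param (I : R -> Prop) (x : R -> E14) : Prop :=
  exists T, tangent_field I x T /\ forall s, I s -> g (T s) (T s) = 1.

Definition causal_signs (e1 e2 : R) : Prop :=
  (e1 = 1 /\ e2 = 1) \/ (e1 = 1 /\ e2 = -1) \/ (e1 = -1 /\ e2 = 1).

(* [frenet_C1] renders the standing smoothness assumption: it holds as soon as
   the curve is of class C^4, and it makes the curvatures continuous. *)
Record frenet_frame (I : R -> Prop) (x : R -> E14) (e1 e2 : R)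
    (T N B1 B2 : R -> E14) (k1 k2 k3 : R -> R) : Prop := {
  frenet_signs : causal_signs e1 e2;
  frenet_tangent : tangent_field I x T;
  frenet_C1 : C1_on I T /\ C1_on I N /\ C1_on I B1 /\ C1_on I B2;
  frenet_norms : forall s, I s ->
    g (T s) (T s) = 1 /\ g (N s) (N s) = e1 /\
    g (B1 s) (B1 s) = - (e1 * e2) /\ g (B2 s) (B2 s) = e2;
  frenet_orthogonal : forall s, I s ->
    g (T s) (N s) = 0 /\ g (T s) (B1 s) = 0 /\ g (T s) (B2 s) = 0 /\
    g (N s) (B1 s) = 0 /\ g (N s) (B2 s) = 0 /\ g (B1 s) (B2 s) = 0;
  frenet_T : forall s, I s -> is_derive T s (scal (k1 s) (N s));
  frenet_N : forall s, I s ->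
    is_derive N s (plus (scal (- (e1 * k1 s)) (T s)) (scal (k2 s) (B1 s)));
  frenet_B1 : forall s, I s ->
    is_derive B1 s (plus (scal (e2 * k2 s) (N s)) (scal (k3 s) (B2 s)));
  frenet_B2 : forall s, I s -> is_derive B2 s (scal (e1 * k3 s) (B1 s))
}.

(* For curves parameterized by arclength, so that the unit tangent is the
   velocity; the constant [c] need not vanish. *)
Definition helix (I : R -> Prop) (x : R -> E14) : Prop :=
  spacelike_curve I x /\
  exists T, tangent_field I x T /\
  exists U : E14, U <> (0, 0, 0, 0) /\
  exists c : R, forall s, I s -> g (T s) U = c.

(* Only used for [e1 = 1] and [e1 = -1]. *)
Definition eta (e1 theta : R) : R :=
  if Req_EM_T e1 1 then cosh theta else cos theta.

Definition mu (e1 theta : R) : R :=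
  if Req_EM_T e1 1 then sinh theta else sin theta.

(* Main.v *)
Require Import Defs.
From Stdlib Require Import Reals Lra.
From Coquelicot Require Import Coquelicot.

Local Open Scope R_scope.

(** The proof replaces vectors by their products with the axis. Write
    [t], [n], [b1], [b2] for the products of [T], [N], [B1], [B2] with a vector
    [U], and [theta] for the integral of [k3] from [0].

    If [U] is an axis, [t] is a constant [c]. The first Frenet equation gives
    [n = 0], the second then gives [e1 * k1 * c = k2 * b1], and the last two
    become [b1' = k3 * b2], [b2' = e1 * k3 * b1]. In the variable [theta] this is
    the equation of [eta] and [mu], so that [b1] is a combination of them with
    constant coefficients ([pseudo_oscillator]). It remains to divide by [c].
    If [c] were zero then [b1], hence [b2], would vanish too, and [U] would be
    orthogonal to the whole frame, which is impossible because a frame of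
    orthogonal non-null vectors is a basis ([orthogonal_to_basis]).

    Conversely, from [C1] and [C2] one knows what [b1] and [b2] have to be if
    [c = 1]; expanding in the frame gives the field
    [T - e1 * e2 * b1 * B1 + e2 * b2 * B2]. Its derivative vanishes by the Frenet
    equations, and its product with [T] is [1], so that it is an axis. *)

(** * The metric *)

Lemma g_sym (u v : E14) : g u v = g v u.
Proof.
destruct u as [[[u1 u2] u3] u4], v as [[[v1 v2] v3] v4]; simpl; ring.
Qed.

Lemma g_plus_l (u v w : E14) : g (plus u v) w = g u w + g v w.
Proof.
destruct u as [[[u1 u2] u3] u4], v as [[[v1 v2] v3] v4], w as [[[w1 w2] w3] w4].
unfold plus; simpl; unfold plus; simpl; ring.
Qed.

Lemma g_scal_l (k : R) (u v : E14) : g (scal k u) v = k * g u v.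
Proof.
destruct u as [[[u1 u2] u3] u4], v as [[[v1 v2] v3] v4].
unfold scal; simpl; unfold scal; simpl; unfold mult; simpl; ring.
Qed.

Lemma g_zero_r (u : E14) : g u (0, 0, 0, 0) = 0.
Proof. destruct u as [[[u1 u2] u3] u4]; simpl; ring. Qed.

Lemma is_linear_lincomb (V : NormedModule R_AbsRing) (k : R) (l1 l2 : V -> R) :
  is_linear l1 -> is_linear l2 -> is_linear (fun v => k * l1 v + l2 v).
Proof.
intros H1 H2.
apply (is_linear_comp (fun v => (k * l1 v, l2 v)) (fun p => plus (fst p) (snd p))).
- apply is_linear_prod; [|exact H2].
  apply (is_linear_comp l1 (fun y : R => scal k y)); [exact H1|].
  exact (@is_linear_scal_r R_AbsRing R_NormedModule k Rmult_comm).
- exact is_linear_plus.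
Qed.

Lemma is_linear_g_l (w : E14) : is_linear (fun v : E14 => g v w).
Proof.
destruct w as [[[w1 w2] w3] w4].
apply is_linear_ext with
  (fun v : E14 => - w1 * fst (fst (fst v)) + (w2 * snd (fst (fst v)) +
                 (w3 * snd (fst v) + (w4 * snd v + 0)))).
- intros [[[v1 v2] v3] v4]; simpl; ring.
- repeat apply is_linear_lincomb.
  + apply (is_linear_comp (fun v : E14 => fst (fst v)) fst); [|apply is_linear_fst].
    apply (is_linear_comp (fun v : E14 => fst v) fst); apply is_linear_fst.
  + apply (is_linear_comp (fun v : E14 => fst (fst v)) snd); [|apply is_linear_snd].
    apply (is_linear_comp (fun v : E14 => fst v) fst); apply is_linear_fst.
  + apply (is_linear_comp (fun v : E14 => fst v) snd);
      [apply is_linear_fst|apply is_linear_snd].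
  + apply is_linear_snd.
  + exact (@is_linear_zero R_AbsRing _ R_NormedModule).
Qed.

Lemma is_derive_g_l (V : R -> E14) (s : R) (V' w : E14) :
  is_derive V s V' -> is_derive (fun s => g (V s) w) s (g V' w).
Proof.
intros H.
apply filterdiff_ext_lin with (fun y : R => g (scal y V') w).
- refine (filterdiff_comp' V (fun v => g v w) s (fun y => scal y V')
            (fun v => g v w) H _).
  apply filterdiff_linear, is_linear_g_l.
- intros y; exact (g_scal_l y V' w).
Qed.

Lemma continuous_g_l (V : R -> E14) (s : R) (w : E14) :
  continuous V s -> continuous (fun s => g (V s) w) s.
Proof.
intros H; apply (continuous_comp V (fun v => g v w)); [exact H|].
exact (linear_cont (fun v => g v w) (V s) (is_linear_g_l w)).
Qed.

(** Testing against a vector brings the uniqueness of derivatives of curves down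
    to that of real functions. *)
Lemma is_derive_g_unique (V : R -> E14) (s : R) (V1 V2 w : E14) :
  is_derive V s V1 -> is_derive V s V2 -> g V1 w = g V2 w.
Proof.
intros H1 H2.
rewrite <- (is_derive_unique _ _ _ (is_derive_g_l V s V1 w H1)).
exact (is_derive_unique _ _ _ (is_derive_g_l V s V2 w H2)).
Qed.

(** * Orthogonal non-null vectors form a basis *)

(** The Laplace expansion along the first two rows. *)
Definition det16 (a1 a2 a3 a4 b1 b2 b3 b4 c1 c2 c3 c4 d1 d2 d3 d4 : R) : R :=
  (a1 * b2 - a2 * b1) * (c3 * d4 - c4 * d3) -
  (a1 * b3 - a3 * b1) * (c2 * d4 - c4 * d2) +
  (a1 * b4 - a4 * b1) * (c2 * d3 - c3 * d2) +
  (a2 * b3 - a3 * b2) * (c1 * d4 - c4 * d1) -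
  (a2 * b4 - a4 * b2) * (c1 * d3 - c3 * d1) +
  (a3 * b4 - a4 * b3) * (c1 * d2 - c2 * d1).

Definition det4 (a b c d : E14) : R :=
  let '(a1, a2, a3, a4) := a in
  let '(b1, b2, b3, b4) := b in
  let '(c1, c2, c3, c4) := c in
  let '(d1, d2, d3, d4) := d in
  det16 a1 a2 a3 a4 b1 b2 b3 b4 c1 c2 c3 c4 d1 d2 d3 d4.

(** The mixed Gram matrix is [A * J * A'^T] where [J] is the matrix of the
    metric, of determinant [-1]. *)
Lemma det4_gram (a b c d a' b' c' d' : E14) :
  det4 a b c d * det4 a' b' c' d' =
  - det16 (g a a') (g a b') (g a c') (g a d') (g b a') (g b b') (g b c') (g b d')
          (g c a') (g c b') (g c c') (g c d') (g d a') (g d b') (g d c') (g d d').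
Proof.
destruct a as [[[? ?] ?] ?], b as [[[? ?] ?] ?], c as [[[? ?] ?] ?],
  d as [[[? ?] ?] ?], a' as [[[? ?] ?] ?], b' as [[[? ?] ?] ?],
  c' as [[[? ?] ?] ?], d' as [[[? ?] ?] ?].
unfold det4, g, det16; ring.
Qed.

(** The Gram determinant of the four vectors is the product of their norms, so
    their determinant is not zero. Multiplied by the determinant of [U]
    and any three vectors it gives a Gram matrix with a zero column; hence every
    determinant with first row [U] vanishes, in particular the coordinates
    of [U]. *)
Lemma orthogonal_to_basis (a b c d U : E14) :
  g a a <> 0 -> g b b <> 0 -> g c c <> 0 -> g d d <> 0 ->
  g a b = 0 -> g a c = 0 -> g a d = 0 -> g b c = 0 -> g b d = 0 -> g c d = 0 ->
  g a U = 0 -> g b U = 0 -> g c U = 0 -> g d U = 0 -> U = (0, 0, 0, 0).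
Proof.
intros na nb nc nd ab ac ad bc bd cd aU bU cU dU.
assert (Hdet : det4 a b c d <> 0).
{ intros H0.
  assert (H := det4_gram a b c d a b c d).
  rewrite (g_sym b a), (g_sym c a), (g_sym d a), (g_sym c b), (g_sym d b),
    (g_sym d c), ab, ac, ad, bc, bd, cd, H0 in H.
  unfold det16 in H.
  assert (Hp : g a a * g b b * (g c c * g d d) <> 0)
    by (repeat apply Rmult_integral_contrapositive_currified; assumption).
  apply Hp; lra. }
assert (HU : forall p q r, det4 U p q r = 0).
{ intros p q r.
  apply Rmult_eq_reg_l with (det4 a b c d); [|exact Hdet].
  rewrite det4_gram, aU, bU, cU, dU; unfold det16; ring. }
assert (H1 := HU (0, 1, 0, 0) (0, 0, 1, 0) (0, 0, 0, 1)).
assert (H2 := HU (1, 0, 0, 0) (0, 0, 1, 0) (0, 0, 0, 1)).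
assert (H3 := HU (1, 0, 0, 0) (0, 1, 0, 0) (0, 0, 0, 1)).
assert (H4 := HU (1, 0, 0, 0) (0, 1, 0, 0) (0, 0, 1, 0)).
destruct U as [[[u1 u2] u3] u4]; unfold det4, det16 in *.
f_equal; [f_equal; [f_equal|]|]; lra.
Qed.

(** * Functions on an open interval *)

Lemma open_itv_locally (a b : Rbar) (s : R) :
  open_itv a b s -> locally s (open_itv a b).
Proof.
intros [Ha Hb].
apply filter_and; [exact (open_Rbar_gt a s Ha)|exact (open_Rbar_lt b s Hb)].
Qed.

Lemma open_itv_between (a b : Rbar) (s t u : R) :
  open_itv a b s -> open_itv a b t -> Rmin s t <= u <= Rmax s t -> open_itv a b u.
Proof.
intros [Has Hsb] [Hat Htb] [Hmin Hmax]; split.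
- apply Rbar_lt_le_trans with (Rmin s t); [|exact Hmin].
  unfold Rmin; destruct (Rle_dec s t); assumption.
- apply Rbar_le_lt_trans with (Rmax s t); [exact Hmax|].
  unfold Rmax; destruct (Rle_dec s t); assumption.
Qed.

Lemma constant_on_itv (a b : Rbar) (f : R -> R) (s t : R) :
  (forall u, open_itv a b u -> is_derive f u 0) ->
  open_itv a b s -> open_itv a b t -> f s = f t.
Proof.
assert (Hlt : forall s t, (forall u, open_itv a b u -> is_derive f u 0) ->
  open_itv a b s -> open_itv a b t -> s < t -> f s = f t).
{ intros s' t' Hf Hs Ht Hst; apply (eq_is_derive f); [|exact Hst].
  intros u Hu; apply Hf; apply (open_itv_between a b s' t' u Hs Ht).
  rewrite Rmin_left, Rmax_right; lra. }
intros Hf Hs Ht; destruct (Rtotal_order s t) as [H|[H|H]].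
- exact (Hlt s t Hf Hs Ht H).
- now rewrite H.
- symmetry; exact (Hlt t s Hf Ht Hs H).
Qed.

Lemma derive_constant_on_itv (a b : Rbar) (f : R -> R) (c l s : R) :
  (forall u, open_itv a b u -> f u = c) -> open_itv a b s -> is_derive f s l -> l = 0.
Proof.
intros Hf Hs Hl.
rewrite <- (is_derive_unique f s l Hl); apply is_derive_unique.
apply (is_derive_ext_loc (fun _ => c)).
- apply filter_imp with (2 := open_itv_locally a b s Hs).
  intros u Hu; symmetry; exact (Hf u Hu).
- apply @is_derive_const.
Qed.

Lemma is_derive_RInt_on_itv (a b : Rbar) (k : R -> R) (s0 s : R) :
  (forall u, open_itv a b u -> continuous k u) ->
  open_itv a b s0 -> open_itv a b s -> is_derive (RInt k s0) s (k s).
Proof.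
intros Hk Hs0 Hs; apply (is_derive_RInt k _ s0); [|exact (Hk s Hs)].
apply filter_imp with (2 := open_itv_locally a b s Hs).
intros t Ht; apply (@RInt_correct R_CompleteNormedModule).
apply (@ex_RInt_continuous R_CompleteNormedModule).
intros z Hz; apply Hk; exact (open_itv_between a b s0 t z Hs0 Ht Hz).
Qed.

(** * The functions eta and mu *)

Lemma is_derive_eta (e t : R) :
  e = 1 \/ e = -1 -> is_derive (eta e) t (e * mu e t).
Proof.
intros He; unfold eta, mu; destruct (Req_EM_T e 1) as [->|Hn].
- rewrite Rmult_1_l; apply is_derive_Reals, derivable_pt_lim_cosh.
- assert (Hm : e = -1) by (destruct He; [contradiction|assumption]).
  replace (e * sin t) with (- sin t) by (rewrite Hm; ring).
  apply is_derive_Reals, derivable_pt_lim_cos.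
Qed.

Lemma is_derive_mu (e t : R) : is_derive (mu e) t (eta e t).
Proof.
unfold eta, mu; destruct (Req_EM_T e 1).
- apply is_derive_Reals, derivable_pt_lim_sinh.
- apply is_derive_Reals, derivable_pt_lim_sin.
Qed.

Lemma eta_mu_pythagoras (e t : R) :
  e = 1 \/ e = -1 -> eta e t * eta e t - e * (mu e t * mu e t) = 1.
Proof.
intros He; unfold eta, mu; destruct (Req_EM_T e 1) as [->|Hn].
- unfold cosh, sinh.
  assert (H : exp t * exp (- t) = 1) by (rewrite <- exp_plus, Rplus_opp_r; apply exp_0).
  nra.
- assert (Hm : e = -1) by (destruct He; [contradiction|assumption]).
  rewrite Hm; generalize (sin2_cos2 t); unfold Rsqr; lra.
Qed.

Lemma is_derive_eta_comp (e : R) (th : R -> R) (s k : R) :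
  e = 1 \/ e = -1 -> is_derive th s k ->
  is_derive (fun s => eta e (th s)) s (k * (e * mu e (th s))).
Proof.
intros He Hth; exact (is_derive_comp (eta e) th s _ _ (is_derive_eta e _ He) Hth).
Qed.

Lemma is_derive_mu_comp (e : R) (th : R -> R) (s k : R) :
  is_derive th s k -> is_derive (fun s => mu e (th s)) s (k * eta e (th s)).
Proof.
intros Hth; exact (is_derive_comp (mu e) th s _ _ (is_derive_mu e _) Hth).
Qed.

Lemma is_derive_Rmult (f1 f2 : R -> R) (s l1 l2 : R) :
  is_derive f1 s l1 -> is_derive f2 s l2 ->
  is_derive (fun s => f1 s * f2 s) s (l1 * f2 s + f1 s * l2).
Proof. intros H1 H2; exact (is_derive_mult f1 f2 s l1 l2 H1 H2 Rmult_comm). Qed.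

(** With respect to [th] the system is solved by the pairs [(eta, e * mu)] and
    [(mu, eta)]. Applying to [(b1, b2)] the inverse of the fundamental matrix with entries
    [eta], [mu], [e * mu], [eta], whose determinant is [1], gives quantities with
    zero derivative: these are the two coefficients. *)
Lemma pseudo_oscillator (a b : Rbar) (e s0 : R) (th k b1 b2 : R -> R) :
  e = 1 \/ e = -1 -> open_itv a b s0 ->
  (forall s, open_itv a b s -> is_derive th s (k s)) ->
  (forall s, open_itv a b s -> is_derive b1 s (k s * b2 s)) ->
  (forall s, open_itv a b s -> is_derive b2 s (e * k s * b1 s)) ->
  exists P Q : R, forall s, open_itv a b s ->
    b1 s = P * eta e (th s) + Q * mu e (th s).
Proof.
intros He Hs0 Hth Hb1 Hb2.
pose (p := fun s => eta e (th s) * b1 s - mu e (th s) * b2 s).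
pose (q := fun s => eta e (th s) * b2 s - e * (mu e (th s) * b1 s)).
assert (Hp : forall s, open_itv a b s -> is_derive p s 0).
{ intros s Hs.
  assert (H := is_derive_minus _ _ _ _ _
    (is_derive_Rmult _ _ _ _ _ (is_derive_eta_comp e th s _ He (Hth s Hs)) (Hb1 s Hs))
    (is_derive_Rmult _ _ _ _ _ (is_derive_mu_comp e th s _ (Hth s Hs)) (Hb2 s Hs))).
  refine (eq_ind _ (fun l => is_derive p s l) H _ _).
  unfold minus, plus, opp; simpl; ring. }
assert (Hq : forall s, open_itv a b s -> is_derive q s 0).
{ intros s Hs.
  assert (H := is_derive_minus _ _ _ _ _
    (is_derive_Rmult _ _ _ _ _ (is_derive_eta_comp e th s _ He (Hth s Hs)) (Hb2 s Hs))
    (is_derive_scal _ _ e _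
      (is_derive_Rmult _ _ _ _ _ (is_derive_mu_comp e th s _ (Hth s Hs)) (Hb1 s Hs)))).
  refine (eq_ind _ (fun l => is_derive q s l) H _ _).
  unfold minus, plus, opp; simpl; ring. }
exists (p s0), (q s0); intros s Hs.
rewrite <- (constant_on_itv a b p s s0 Hp Hs Hs0).
rewrite <- (constant_on_itv a b q s s0 Hq Hs Hs0).
unfold p, q.
assert (H := eta_mu_pythagoras e (th s) He).
transitivity ((eta e (th s) * eta e (th s) - e * (mu e (th s) * mu e (th s))) * b1 s);
  [rewrite H; ring|ring].
Qed.

(** * Frenet frames *)

Lemma causal_signs_unit (e1 e2 : R) :
  causal_signs e1 e2 -> (e1 = 1 \/ e1 = -1) /\ (e2 = 1 \/ e2 = -1).
Proof. unfold causal_signs; intuition. Qed.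

Section Frame.

Variables (a b : Rbar) (x : R -> E14) (e1 e2 : R) (T N B1 B2 : R -> E14)
  (k1 k2 k3 : R -> R).
Hypothesis hframe : frenet_frame (open_itv a b) x e1 e2 T N B1 B2 k1 k2 k3.

Lemma sign_e1 : e1 = 1 \/ e1 = -1.
Proof. exact (proj1 (causal_signs_unit e1 e2 (frenet_signs _ _ _ _ _ _ _ _ _ _ _ hframe))). Qed.

Lemma sign_e2 : e2 = 1 \/ e2 = -1.
Proof. exact (proj2 (causal_signs_unit e1 e2 (frenet_signs _ _ _ _ _ _ _ _ _ _ _ hframe))). Qed.

Lemma frenet_T_g (U : E14) (s : R) : open_itv a b s ->
  is_derive (fun s => g (T s) U) s (k1 s * g (N s) U).
Proof.
intros Hs; rewrite <- g_scal_l.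
apply is_derive_g_l, (frenet_T _ _ _ _ _ _ _ _ _ _ _ hframe s Hs).
Qed.

Lemma frenet_N_g (U : E14) (s : R) : open_itv a b s ->
  is_derive (fun s => g (N s) U) s (- (e1 * k1 s) * g (T s) U + k2 s * g (B1 s) U).
Proof.
intros Hs; rewrite <- !g_scal_l, <- g_plus_l.
apply is_derive_g_l, (frenet_N _ _ _ _ _ _ _ _ _ _ _ hframe s Hs).
Qed.

Lemma frenet_B1_g (U : E14) (s : R) : open_itv a b s ->
  is_derive (fun s => g (B1 s) U) s (e2 * k2 s * g (N s) U + k3 s * g (B2 s) U).
Proof.
intros Hs; rewrite <- !g_scal_l, <- g_plus_l.
apply is_derive_g_l, (frenet_B1 _ _ _ _ _ _ _ _ _ _ _ hframe s Hs).
Qed.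

Lemma frenet_B2_g (U : E14) (s : R) : open_itv a b s ->
  is_derive (fun s => g (B2 s) U) s (e1 * k3 s * g (B1 s) U).
Proof.
intros Hs; rewrite <- g_scal_l.
apply is_derive_g_l, (frenet_B2 _ _ _ _ _ _ _ _ _ _ _ hframe s Hs).
Qed.

(** The last Frenet equation, tested against the value of [B1] at the point,
    writes [k3] near that point as a quotient of continuous functions. *)
Lemma continuous_k3 (s : R) : open_itv a b s -> continuous k3 s.
Proof.
intros Hs.
destruct (frenet_C1 _ _ _ _ _ _ _ _ _ _ _ hframe)
  as (_ & _ & [B1' HB1] & [B2' HB2]).
pose (W := B1 s).
assert (He1 := sign_e1); assert (He2 := sign_e2).
assert (HW : g (B1 s) W <> 0).
{ destruct (frenet_norms _ _ _ _ _ _ _ _ _ _ _ hframe s Hs) as (_ & _ & H & _).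
  unfold W; rewrite H; destruct He1 as [->| ->], He2 as [->| ->]; lra. }
assert (Hc1 : continuous (fun t => g (B1 t) W) s).
{ apply continuous_g_l.
  exact (ex_derive_continuous _ _ (ex_intro _ (B1' s) (proj1 (HB1 s Hs)))). }
apply continuous_ext_loc with (fun t => e1 * (g (B2' t) W * / g (B1 t) W)).
- apply filter_imp with (fun t => open_itv a b t /\ g (B1 t) W <> 0).
  + intros t [Ht Hnz].
    rewrite (is_derive_g_unique B2 t _ (scal (e1 * k3 t) (B1 t)) W (proj1 (HB2 t Ht))
               (frenet_B2 _ _ _ _ _ _ _ _ _ _ _ hframe t Ht)).
    rewrite g_scal_l; change (e1 * (e1 * k3 t * g (B1 t) W * / g (B1 t) W) = k3 t).
    destruct He1 as [->| ->]; field; exact Hnz.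
  + apply filter_and; [exact (open_itv_locally a b s Hs)|].
    apply (Hc1 (fun y => y <> 0)), open_neq, HW.
- refine (continuous_scal_r e1 (fun t => g (B2' t) W * / g (B1 t) W) s _).
  apply (continuous_mult (fun t => g (B2' t) W) (fun t => / g (B1 t) W)).
  + apply continuous_g_l; exact (proj2 (HB2 s Hs)).
  + apply continuous_Rinv_comp; assumption.
Qed.

Hypothesis hk : forall s, open_itv a b s -> k1 s <> 0 /\ k2 s <> 0 /\ k3 s <> 0.
Hypothesis h0 : open_itv a b 0.

Lemma is_derive_theta (s : R) : open_itv a b s -> is_derive (RInt k3 0) s (k3 s).
Proof. intros Hs; exact (is_derive_RInt_on_itv a b k3 0 s continuous_k3 h0 Hs). Qed.

Lemma axis_orthogonal_to_N (U : E14) (c : R) :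
  (forall s, open_itv a b s -> g (T s) U = c) ->
  forall s, open_itv a b s -> g (N s) U = 0.
Proof.
intros Hc s Hs; destruct (hk s Hs) as (Hk1 & _ & _).
assert (H := derive_constant_on_itv a b _ c _ s Hc Hs (frenet_T_g U s Hs)).
destruct (Rmult_integral _ _ H); [contradiction|assumption].
Qed.

Lemma axis_curvature_ratio (U : E14) (c : R) :
  (forall s, open_itv a b s -> g (T s) U = c) ->
  forall s, open_itv a b s -> k1 s / k2 s * c = e1 * g (B1 s) U.
Proof.
intros Hc s Hs; destruct (hk s Hs) as (_ & Hk2 & _).
assert (H := derive_constant_on_itv a b _ 0 _ s (axis_orthogonal_to_N U c Hc) Hs
               (frenet_N_g U s Hs)).
rewrite (Hc s Hs) in H.
apply Rmult_eq_reg_l with (k2 s); [|exact Hk2].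
replace (k2 s * (k1 s / k2 s * c)) with (k1 s * c) by (field; exact Hk2).
destruct sign_e1 as [E|E]; rewrite E in *; lra.
Qed.

Lemma axis_derive_B1 (U : E14) (c : R) :
  (forall s, open_itv a b s -> g (T s) U = c) ->
  forall s, open_itv a b s ->
    is_derive (fun s => g (B1 s) U) s (k3 s * g (B2 s) U).
Proof.
intros Hc s Hs; assert (H := frenet_B1_g U s Hs).
rewrite (axis_orthogonal_to_N U c Hc s Hs), Rmult_0_r, Rplus_0_l in H; exact H.
Qed.

(** An axis orthogonal to [T] would be orthogonal to [B1] by the curvature ratio,
    hence to [B2] because [k3] does not vanish, and so to the whole frame. *)
Lemma axis_angle_neq0 (U : E14) (c : R) :
  U <> (0, 0, 0, 0) -> (forall s, open_itv a b s -> g (T s) U = c) -> c <> 0.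
Proof.
intros HU Hc Hc0; apply HU.
assert (HB1 : forall s, open_itv a b s -> g (B1 s) U = 0).
{ intros s Hs; assert (H := axis_curvature_ratio U c Hc s Hs).
  rewrite Hc0, Rmult_0_r in H; destruct sign_e1 as [E|E]; rewrite E in H; lra. }
assert (HB2 : g (B2 0) U = 0).
{ assert (H := derive_constant_on_itv a b _ 0 _ 0 HB1 h0 (axis_derive_B1 U c Hc 0 h0)).
  destruct (hk 0 h0) as (_ & _ & Hk3).
  destruct (Rmult_integral _ _ H); [contradiction|assumption]. }
destruct (frenet_norms _ _ _ _ _ _ _ _ _ _ _ hframe 0 h0) as (nT & nN & nB1 & nB2).
destruct (frenet_orthogonal _ _ _ _ _ _ _ _ _ _ _ hframe 0 h0)
  as (TN & TB1 & TB2 & NB1 & NB2 & B12).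
assert (He1 := sign_e1); assert (He2 := sign_e2).
apply (orthogonal_to_basis (T 0) (N 0) (B1 0) (B2 0)); try assumption.
- rewrite nT; lra.
- rewrite nN; lra.
- rewrite nB1; destruct He1 as [->| ->], He2 as [->| ->]; lra.
- rewrite nB2; lra.
- rewrite (Hc 0 h0); exact Hc0.
- exact (axis_orthogonal_to_N U c Hc 0 h0).
- exact (HB1 0 h0).
Qed.

Lemma curvature_ratio_of_helix : helix (open_itv a b) x ->
  exists C1 C2 : R, forall s, open_itv a b s ->
    k1 s / k2 s = C1 * eta e1 (RInt k3 0 s) + C2 * mu e1 (RInt k3 0 s).
Proof.
intros (_ & T' & HT' & U & HU & c & HT'c).
assert (Hc : forall s, open_itv a b s -> g (T s) U = c).
{ intros s Hs; rewrite <- (HT'c s Hs).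
  apply (is_derive_g_unique x s); [|exact (HT' s Hs)].
  exact (frenet_tangent _ _ _ _ _ _ _ _ _ _ _ hframe s Hs). }
destruct (pseudo_oscillator a b e1 0 (RInt k3 0) k3
  (fun s => g (B1 s) U) (fun s => g (B2 s) U) sign_e1 h0 is_derive_theta
  (axis_derive_B1 U c Hc) (frenet_B2_g U)) as (P & Q & HPQ).
assert (Hc0 := axis_angle_neq0 U c HU Hc).
exists (e1 * P / c), (e1 * Q / c); intros s Hs.
apply Rmult_eq_reg_r with c; [|exact Hc0].
rewrite (axis_curvature_ratio U c Hc s Hs); cbv beta in HPQ; rewrite (HPQ s Hs).
field; exact Hc0.
Qed.

(** The candidate axis, expanded in the frame: [b1] and [b2] are its products
    with [B1] and [B2], and its product with [T] is [1]. *)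
Definition axis_field (b1 b2 : R -> R) (s : R) : E14 :=
  plus (T s) (plus (scal (- (e1 * e2) * b1 s) (B1 s)) (scal (e2 * b2 s) (B2 s))).

Lemma g_axis_field (b1 b2 : R -> R) (W : E14) (s : R) :
  g (axis_field b1 b2 s) W =
  g (T s) W + (- (e1 * e2) * (b1 s * g (B1 s) W) + e2 * (b2 s * g (B2 s) W)).
Proof. unfold axis_field; rewrite !g_plus_l, !g_scal_l; ring. Qed.

Lemma g_axis_field_T (b1 b2 : R -> R) (s : R) :
  open_itv a b s -> g (axis_field b1 b2 s) (T s) = 1.
Proof.
intros Hs; rewrite g_axis_field, (g_sym (B1 s)), (g_sym (B2 s)).
destruct (frenet_norms _ _ _ _ _ _ _ _ _ _ _ hframe s Hs) as (-> & _).
destruct (frenet_orthogonal _ _ _ _ _ _ _ _ _ _ _ hframe s Hs) as (_ & -> & -> & _).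
ring.
Qed.

(** In the derivative the [N] terms cancel because [e1 * k2 * b1 = k1], and the
    [B1] and [B2] terms because of the system for [b1], [b2]. *)
Lemma axis_field_constant (b1 b2 : R -> R) (W : E14) (s t : R) :
  (forall u, open_itv a b u -> k2 u * b1 u = e1 * k1 u) ->
  (forall u, open_itv a b u -> is_derive b1 u (k3 u * b2 u)) ->
  (forall u, open_itv a b u -> is_derive b2 u (e1 * k3 u * b1 u)) ->
  open_itv a b s -> open_itv a b t ->
  g (axis_field b1 b2 s) W = g (axis_field b1 b2 t) W.
Proof.
intros Hr Hb1 Hb2; apply (constant_on_itv a b (fun s => g (axis_field b1 b2 s) W)).
intros u Hu.
apply is_derive_ext with (fun s => g (T s) W +
  (- (e1 * e2) * (b1 s * g (B1 s) W) + e2 * (b2 s * g (B2 s) W))).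
{ intros v; symmetry; apply g_axis_field. }
assert (H := is_derive_plus _ _ _ _ _ (frenet_T_g W u Hu)
  (is_derive_plus _ _ _ _ _
    (is_derive_scal _ _ (- (e1 * e2)) _
      (is_derive_Rmult _ _ _ _ _ (Hb1 u Hu) (frenet_B1_g W u Hu)))
    (is_derive_scal _ _ e2 _
      (is_derive_Rmult _ _ _ _ _ (Hb2 u Hu) (frenet_B2_g W u Hu))))).
refine (eq_ind _ (fun l => is_derive _ u l) H _ _).
unfold plus; simpl.
assert (S1 : e1 * e1 = 1) by (destruct sign_e1 as [E|E]; rewrite E; ring).
assert (S2 : e2 * e2 = 1) by (destruct sign_e2 as [E|E]; rewrite E; ring).
transitivity (k1 u * g (N u) W - e1 * (e2 * e2) * (k2 u * b1 u) * g (N u) W); [ring|].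
rewrite (Hr u Hu), S2.
transitivity ((1 - e1 * e1) * (k1 u * g (N u) W)); [ring|rewrite S1; ring].
Qed.

Lemma helix_of_curvature_ratio (C1 C2 : R) :
  spacelike_curve (open_itv a b) x ->
  (forall s, open_itv a b s ->
    k1 s / k2 s = C1 * eta e1 (RInt k3 0 s) + C2 * mu e1 (RInt k3 0 s)) ->
  helix (open_itv a b) x.
Proof.
intros hspace HC; split; [exact hspace|].
exists T; split; [exact (frenet_tangent _ _ _ _ _ _ _ _ _ _ _ hframe)|].
assert (S1 : e1 * e1 = 1) by (destruct sign_e1 as [E|E]; rewrite E; ring).
pose (b1 := fun s => e1 * (C1 * eta e1 (RInt k3 0 s) + C2 * mu e1 (RInt k3 0 s))).
(* The derivative of [b1] with respect to theta. *)
pose (b2 := fun s => C1 * mu e1 (RInt k3 0 s) + e1 * (C2 * eta e1 (RInt k3 0 s))).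
assert (Hr : forall u, open_itv a b u -> k2 u * b1 u = e1 * k1 u).
{ intros u Hu; unfold b1; rewrite <- (HC u Hu); field.
  exact (proj1 (proj2 (hk u Hu))). }
assert (Hb1 : forall u, open_itv a b u -> is_derive b1 u (k3 u * b2 u)).
{ intros u Hu.
  assert (H := is_derive_scal _ _ e1 _ (is_derive_plus _ _ _ _ _
    (is_derive_scal _ _ C1 _ (is_derive_eta_comp e1 _ u _ sign_e1 (is_derive_theta u Hu)))
    (is_derive_scal _ _ C2 _ (is_derive_mu_comp e1 _ u _ (is_derive_theta u Hu))))).
  refine (eq_ind _ (fun l => is_derive b1 u l) H _ _).
  unfold plus, b2; simpl.
  transitivity (k3 u * ((e1 * e1) * (C1 * mu e1 (RInt k3 0 u))
                        + e1 * (C2 * eta e1 (RInt k3 0 u)))); [ring|rewrite S1; ring]. }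
assert (Hb2 : forall u, open_itv a b u -> is_derive b2 u (e1 * k3 u * b1 u)).
{ intros u Hu.
  assert (H := is_derive_plus _ _ _ _ _
    (is_derive_scal _ _ C1 _ (is_derive_mu_comp e1 _ u _ (is_derive_theta u Hu)))
    (is_derive_scal _ _ e1 _ (is_derive_scal _ _ C2 _
      (is_derive_eta_comp e1 _ u _ sign_e1 (is_derive_theta u Hu))))).
  refine (eq_ind _ (fun l => is_derive b2 u l) H _ _).
  unfold plus, b1; simpl.
  transitivity (k3 u * (C1 * eta e1 (RInt k3 0 u)
                        + (e1 * e1) * (C2 * mu e1 (RInt k3 0 u))));
    [ring|].
  transitivity (k3 u * ((e1 * e1) * (C1 * eta e1 (RInt k3 0 u)
                        + C2 * mu e1 (RInt k3 0 u)))); [rewrite S1; ring|ring]. }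
assert (HU : forall s, open_itv a b s -> g (T s) (axis_field b1 b2 0) = 1).
{ intros s Hs; rewrite g_sym.
  rewrite <- (axis_field_constant b1 b2 (T s) s 0 Hr Hb1 Hb2 Hs h0).
  exact (g_axis_field_T b1 b2 s Hs). }
exists (axis_field b1 b2 0); split.
- intros H0; assert (H := HU 0 h0); rewrite H0, g_zero_r in H; lra.
- exists 1; exact HU.
Qed.

End Frame.

Theorem theorem3p3 (a b : Rbar) (h0 : open_itv a b 0)
    (x : R -> E14) (e1 e2 : R) (T N B1 B2 : R -> E14) (k1 k2 k3 : R -> R)
    (hspace : spacelike_curve (open_itv a b) x)
    (harc : arclength_param (open_itv a b) x)
    (hframe : frenet_frame (open_itv a b) x e1 e2 T N B1 B2 k1 k2 k3)
    (hk : forall s, open_itv a b s -> k1 s <> 0 /\ k2 s <> 0 /\ k3 s <> 0) :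
  helix (open_itv a b) x <->
  exists C1 C2 : R, forall s, open_itv a b s ->
    k1 s / k2 s = C1 * eta e1 (RInt k3 0 s) + C2 * mu e1 (RInt k3 0 s).
Proof.
split.
- exact (curvature_ratio_of_helix _ _ _ _ _ _ _ _ _ _ _ _ hframe hk h0).
- intros (C1 & C2 & HC).
  exact (helix_of_curvature_ratio _ _ _ _ _ _ _ _ _ _ _ _ hframe hk h0 C1 C2 hspace HC).
Qed.
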